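(* Let $\alpha_i\ge 0$, $\beta_i>0$ ($1\le i\le 5$) and $Q>0$ be real numbers. In the network $N^+$ with these parameters and total flow $Q$, the travel time at equilibrium is as follows: (a) $T^+_{Eq}=\alpha_{135}+Q\beta_{135}$ if $0<Q\le\min\{\hat\alpha/\beta_{35},\,\bar\alpha/\beta_{13}\}$; (b) $T^+_{Eq}=\alpha_{45}+Q\beta_{45}$ if $0<Q\le\min\{-\alpha/\beta_{45},\,-\bar\alpha/\beta_4\}$; (c) $T^+_{Eq}=\alpha_{12}+Q\beta_{12}$ if $0<Q\le\min\{\alpha/\beta_{12},\,-\hat\alpha/\beta_2\}$; (d) $T^+_{Eq}=\alpha_{45}+Q\beta_{45}-(\bar\alpha+Q\beta_4)\beta_4/\beta_{134}$ if $\max\{\bar\alpha/\beta_{13},\,-\bar\alpha/\beta_4\}<Q\le\mu_1$; (e) $T^+_{Eq}=\alpha_{12}+Q\beta_{12}-(\hat\alpha+Q\beta_2)\beta_2/\beta_{235}$ if $\max\{\hat\alpha/\beta_{35},\,-\hat\alpha/\beta_2\}<Q\le\mu_2$; (f) $T^+_{Eq}=\alpha_{12}+(\alpha+Q\beta_{45})\beta_{12}/\beta$ if $Q>\max\{\alpha/\beta_{12},\,-\alpha/\beta_{45}\}$ and $\mathcal B_1\ge\dfrac{\hat\alpha\beta_{14}+\bar\alpha\beta_{25}}{Q}$; (g) $T^+_{Eq}=\alpha_{12}+(\alpha+Q\beta_{45})\beta_{12}/\beta+g\mathcal B_1/\beta$, where $$g=\frac{\bar\alpha\beta-\alpha\beta_{14}-Q\mathcal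 B_1}{\beta_3\beta+\beta_{14}\beta_{25}},$$ if $Q>\max\{\mu_1,\mu_2\}$ and $\mathcal B_1<\dfrac{\hat\alpha\beta_{14}+\bar\alpha\beta_{25}}{Q}$.
   Context: The network $N^+$ has nodes $a,b,c,d$ and directed links $(a,b),(b,d),(b,c),(a,c),(c,d)$ with travel times $\alpha_1+\beta_1f_{ab}$, $\alpha_2+\beta_2f_{bd}$, $\alpha_3+\beta_3f_{bc}$, $\alpha_4+\beta_4f_{ac}$, $\alpha_5+\beta_5f_{cd}$ respectively, where $f_{ij}\ge 0$ is the (real) flow on link $(i,j)$ and $\alpha_i\ge 0$, $\beta_i>0$. All traffic, of total amount $Q>0$ (real), goes from $a$ to $d$ along the paths $P_1=a-b-d$, $P_2=a-c-d$, $P_3=a-b-c-d$. A flow assigns a non-negative real amount to each path, with total $Q$; the flow on a link is the sum of the flows of the paths containing it; the travel time on a path is the sum of the travel times of its links. A path has vanishing flow if its path flow is $0$. The network is at equilibrium if all paths with non-vanishing flow have the same travel time, and every path with vanishing flow has travel time at least this common value. The equilibrium exists and is unique; its common travel time is denoted $T^+_{Eq}$. Notation: multiple indices denote sums, e.g. $\alpha_{ij}=\alpha_i+\alpha_j$, $\beta_{134}=\beta_1+\beta_3+\beta_4$. Further, $\alpha=\alpha_{45}-\alpha_{12}$, $\bar\alpha=\alpha_4-\alpha_{13}$, $\hat\alpha=\alpha_2-\alpha_{35}$, $\beta=\beta_1+\beta_2+\beta_4+\beta_5$, $\mathcal B_1=\beta_1\beta_5-\beta_2\beta_4$, and $$\mu_1=\frac{\hat\alpha\beta_{14}-\alpha\beta_3}{\beta_3\beta_{45}+\beta_5\beta_{14}},\qquad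 \mu_2=\frac{\bar\alpha\beta_{25}+\alpha\beta_3}{\beta_1\beta_{25}+\beta_3\beta_{12}}.$$ *)

(* Defs.v *)
From HB Require Import structures.
From mathcomp Require Import all_boot all_order all_algebra.
From mathcomp Require Import all_classical all_reals.

Set Implicit Arguments.
Unset Strict Implicit.
Unset Printing Implicit Defensive.

Import Order.TTheory GRing.Theory Num.Theory.

Local Open Scope classical_set_scope.
Local Open Scope ring_scope.

(* The network N+ on the nodes a, b, c, d. *)

(* [Lij] is the directed link (i, j). *)
Variant link := Lab | Lbd | Lbc | Lac | Lcd.

Scheme Equality for link.

HB.instance Definition _ := hasDecEq.Build link (compareP link_eq_dec).

(* The three directed paths from a to d: P1 = a-b-d, P2 = a-c-d and
   P3 = a-b-c-d. *)
Variant route := P1 | P2 | P3.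

Definition links_of (p : route) : seq link :=
  match p with
  | P1 => [:: Lab; Lbd]
  | P2 => [:: Lac; Lcd]
  | P3 => [:: Lab; Lbc; Lcd]
  end.

Definition routes : seq route := [:: P1; P2; P3].

Definition is_flow (R : realType) (Q : R) (x : route -> R) : Prop :=
  (forall p, 0 <= x p) /\ \sum_(p <- routes) x p = Q.

Definition link_flow (R : realType) (x : route -> R) (l : link) : R :=
  \sum_(p <- routes | l \in links_of p) x p.

Definition link_time (R : realType) (alpha beta : link -> R)
    (x : route -> R) (l : link) : R :=
  alpha l + beta l * link_flow x l.

Definition path_time (R : realType) (alpha beta : link -> R)
    (x : route -> R) (p : route) : R :=
  \sum_(l <- links_of p) link_time alpha beta x l.

(* The flow [x] of total amount [Q] is an equilibrium with common travel time
   [T].  When Q > 0 some path has non-vanishing flow, so [x] determines [T]. *)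
Definition equilibrium (R : realType) (alpha beta : link -> R) (Q : R)
    (x : route -> R) (T : R) : Prop :=
  [/\ is_flow Q x,
      forall p, x p != 0 -> path_time alpha beta x p = T &
      forall p, x p = 0 -> T <= path_time alpha beta x p].

(* The common travel time at the equilibrium.  [xget] returns the default 0
   only if there is no equilibrium; for alpha >= 0, beta > 0 and Q > 0, every
   equilibrium time is positive, so any positive value of [T_Eq] is attained
   at an actual equilibrium. *)
Definition T_Eq (R : realType) (alpha beta : link -> R) (Q : R) : R :=
  xget 0 [set T | exists x, equilibrium alpha beta Q x T].

(* Main.v *)
(* An equilibrium x of time T satisfies the variational inequality
   Q T <= \sum_p y_p t_p(x) for every flow y, with equality at y = x.  Applied to
   two equilibria, it gives \sum_l beta_l (f_l(x) - f_l(y))^2 <= 0, so that the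
   two flows coincide.  By this uniqueness it suffices to exhibit, in each of
   the seven cases, an equilibrium flow having the claimed travel time. *)

Require Import Defs.
From HB Require Import structures.
From mathcomp Require Import all_boot all_order all_algebra.
From mathcomp Require Import all_classical all_reals.
From mathcomp Require Import ring lra.

Set Implicit Arguments.
Unset Strict Implicit.
Unset Printing Implicit Defensive.

Import Order.TTheory GRing.Theory Num.Theory.

Local Open Scope ring_scope.

Section Equilibrium.

Context {R : realType}.
Implicit Types (alpha beta : link -> R) (x y : route -> R) (Q T : R).

Lemma sum_routes (F : route -> R) : \sum_(p <- routes) F p = F P1 + F P2 + F P3.
Proof. by rewrite /routes !big_cons big_nil addr0 addrA. Qed.

Lemma path_timeE alpha beta x p :
  path_time alpha beta x p =
  match p with
  | P1 => alpha Lab + beta Lab * (x P1 + x P3) + (alpha Lbd + beta Lbd * x P1)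
  | P2 => alpha Lac + beta Lac * x P2 + (alpha Lcd + beta Lcd * (x P2 + x P3))
  | P3 => alpha Lab + beta Lab * (x P1 + x P3) + (alpha Lbc + beta Lbc * x P3)
          + (alpha Lcd + beta Lcd * (x P2 + x P3))
  end.
Proof.
rewrite /path_time /link_time /link_flow /routes.
by case: p; rewrite !big_cons !big_nil /= ?addr0 ?addrA.
Qed.

(** Every path, used by [x] or not, has travel time at least [T]; weighting these bounds by [y p]
    and summing gives the claim, as the weights add up to [Q]. *)
Lemma equilibrium_variational alpha beta Q x T y :
  equilibrium alpha beta Q x T -> is_flow Q y ->
  Q * T <= \sum_(p <- routes) y p * path_time alpha beta x p.
Proof.
move=> [_ tE tge] [y_ge0 <-]; rewrite mulr_suml; apply: ler_sum => p _.
apply: ler_wpM2l => //; have [/tge //|/tE ->] := eqVneq (x p) 0.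
by [].
Qed.

(** Only paths with non-vanishing flow contribute, and all of these take time [T]. *)
Lemma equilibrium_total_time alpha beta Q x T :
  equilibrium alpha beta Q x T ->
  \sum_(p <- routes) x p * path_time alpha beta x p = Q * T.
Proof.
move=> [[_ <-] tE _]; rewrite mulr_suml; apply: eq_bigr => p _.
by have [->|/tE ->//] := eqVneq (x p) 0; rewrite !mul0r.
Qed.

Lemma equilibrium_flow_unique alpha beta Q x T y U :
  (forall l, 0 < beta l) ->
  equilibrium alpha beta Q x T -> equilibrium alpha beta Q y U -> x =1 y.
Proof.
move=> beta_gt0 ex ey.
have := equilibrium_variational ex (let: And3 h _ _ := ey in h).
have := equilibrium_variational ey (let: And3 h _ _ := ex in h).
rewrite -(equilibrium_total_time ex) -(equilibrium_total_time ey).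
rewrite !sum_routes !path_timeE => hy hx.
pose d p := x p - y p.
have sq l (z : R) : 0 <= beta l * z ^+ 2 by rewrite mulr_ge0 ?sqr_ge0 ?ltW.
have sq0 l z : beta l * z ^+ 2 <= 0 -> z = 0.
  by rewrite pmulr_rle0 // => z2; apply/eqP; rewrite -sqrf_eq0 eq_le z2 sqr_ge0.
(* The sum of [hx] and [hy]: the constant terms [alpha l] cancel, and regrouping by links leaves the
   squared differences of link flows. *)
have h : beta Lab * (d P1 + d P3) ^+ 2 + beta Lbd * d P1 ^+ 2
    + beta Lbc * d P3 ^+ 2 + beta Lac * d P2 ^+ 2
    + beta Lcd * (d P2 + d P3) ^+ 2 <= 0.
  rewrite /d; lra.
have := (sq Lab (d P1 + d P3), sq Lbd (d P1), sq Lbc (d P3), sq Lac (d P2),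
  sq Lcd (d P2 + d P3)) => - [[[[h1 h2] h3] h4] h5].
(* Each of the links bd, ac, bc lies on exactly one path, so its flow is that of P1, P2, P3
   respectively. *)
by case; apply/eqP; rewrite -subr_eq0; apply/eqP;
  [apply: (sq0 Lbd)|apply: (sq0 Lac)|apply: (sq0 Lbc)]; rewrite -/(d _); lra.
Qed.

Lemma equilibrium_time_unique alpha beta Q x T y U :
  (forall l, 0 < beta l) -> 0 < Q ->
  equilibrium alpha beta Q x T -> equilibrium alpha beta Q y U -> T = U.
Proof.
move=> beta_gt0 Q_gt0 ex ey; have xy := equilibrium_flow_unique beta_gt0 ex ey.
apply: (mulfI (lt0r_neq0 Q_gt0)).
rewrite -(equilibrium_total_time ex) -(equilibrium_total_time ey).
by rewrite !sum_routes !path_timeE !xy.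
Qed.

Lemma T_EqE alpha beta Q x T :
  (forall l, 0 < beta l) -> 0 < Q ->
  equilibrium alpha beta Q x T -> T_Eq alpha beta Q = T.
Proof.
move=> beta_gt0 Q_gt0 ex; apply: xget_unique; first by exists x.
by move=> U [y ey]; apply: equilibrium_time_unique ey ex.
Qed.

(** Equilibrium as complementary slackness: [wi] is the excess of the time on the i-th path over
    [T], and it vanishes wherever the path is used. Each case of the theorem then reduces to sign
    conditions and field identities. *)
Lemma T_Eq_slack alpha beta Q (x1 x2 x3 w1 w2 w3 : R) T :
  (forall l, 0 < beta l) -> 0 < Q ->
  [/\ 0 <= x1, 0 <= x2, 0 <= x3 & x1 + x2 + x3 = Q] ->
  [/\ 0 <= w1, 0 <= w2 & 0 <= w3] ->
  [/\ x1 * w1 = 0, x2 * w2 = 0 & x3 * w3 = 0] ->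
  alpha Lab + beta Lab * (x1 + x3) + (alpha Lbd + beta Lbd * x1) = T + w1 ->
  alpha Lac + beta Lac * x2 + (alpha Lcd + beta Lcd * (x2 + x3)) = T + w2 ->
  alpha Lab + beta Lab * (x1 + x3) + (alpha Lbc + beta Lbc * x3)
    + (alpha Lcd + beta Lcd * (x2 + x3)) = T + w3 ->
  T_Eq alpha beta Q = T.
Proof.
move=> beta_gt0 Q_gt0 [x1_ge0 x2_ge0 x3_ge0 xQ] [w1_ge0 w2_ge0 w3_ge0] [c1 c2 c3].
pose x p := match p with P1 => x1 | P2 => x2 | P3 => x3 end.
pose w p := match p with P1 => w1 | P2 => w2 | P3 => w3 end.
move=> t1 t2 t3.
have tE p : path_time alpha beta x p = T + w p by rewrite path_timeE; case: p.
have w_ge0 p : 0 <= w p by case: p.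
have c p : x p * w p = 0 by case: p.
apply: (T_EqE (x := x)) => //; split=> [|p xp|p _]; rewrite ?tE ?lerDl //.
  by split; [case|rewrite sum_routes].
by rewrite (mulfI xp (etrans (c p) (esym (mulr0 _)))) addr0.
Qed.

End Equilibrium.

Theorem lemma2 (R : realType) (alpha_ beta_ : link -> R) (Q : R)
    (alpha_ge0 : forall l, 0 <= alpha_ l)
    (beta_gt0 : forall l, 0 < beta_ l)
    (Q_gt0 : 0 < Q) :
  let alpha1 := alpha_ Lab in let beta1 := beta_ Lab in
  let alpha2 := alpha_ Lbd in let beta2 := beta_ Lbd in
  let alpha3 := alpha_ Lbc in let beta3 := beta_ Lbc in
  let alpha4 := alpha_ Lac in let beta4 := beta_ Lac in
  let alpha5 := alpha_ Lcd in let beta5 := beta_ Lcd in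
  let alpha := (alpha4 + alpha5) - (alpha1 + alpha2) in
  let alphabar := alpha4 - (alpha1 + alpha3) in
  let alphahat := alpha2 - (alpha3 + alpha5) in
  let beta := beta1 + beta2 + beta4 + beta5 in
  let B1 := beta1 * beta5 - beta2 * beta4 in
  let mu1 := (alphahat * (beta1 + beta4) - alpha * beta3)
             / (beta3 * (beta4 + beta5) + beta5 * (beta1 + beta4)) in
  let mu2 := (alphabar * (beta2 + beta5) + alpha * beta3)
             / (beta1 * (beta2 + beta5) + beta3 * (beta1 + beta2)) in
  let g := (alphabar * beta - alpha * (beta1 + beta4) - Q * B1)
           / (beta3 * beta + (beta1 + beta4) * (beta2 + beta5)) in
  let T := T_Eq alpha_ beta_ Q in
  (* (a) *)
  (0 < Q <= Num.min (alphahat / (beta3 + beta5)) (alphabar / (beta1 + beta3)) ->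
   T = (alpha1 + alpha3 + alpha5) + Q * (beta1 + beta3 + beta5))
  /\
  (* (b) *)
  (0 < Q <= Num.min (- alpha / (beta4 + beta5)) (- alphabar / beta4) ->
   T = (alpha4 + alpha5) + Q * (beta4 + beta5))
  /\
  (* (c) *)
  (0 < Q <= Num.min (alpha / (beta1 + beta2)) (- alphahat / beta2) ->
   T = (alpha1 + alpha2) + Q * (beta1 + beta2))
  /\
  (* (d) *)
  (Num.max (alphabar / (beta1 + beta3)) (- alphabar / beta4) < Q <= mu1 ->
   T = (alpha4 + alpha5) + Q * (beta4 + beta5)
       - (alphabar + Q * beta4) * beta4 / (beta1 + beta3 + beta4))
  /\
  (* (e) *)
  (Num.max (alphahat / (beta3 + beta5)) (- alphahat / beta2) < Q <= mu2 ->
   T = (alpha1 + alpha2) + Q * (beta1 + beta2)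
       - (alphahat + Q * beta2) * beta2 / (beta2 + beta3 + beta5))
  /\
  (* (f) *)
  (Num.max (alpha / (beta1 + beta2)) (- alpha / (beta4 + beta5)) < Q ->
   (alphahat * (beta1 + beta4) + alphabar * (beta2 + beta5)) / Q <= B1 ->
   T = (alpha1 + alpha2)
       + (alpha + Q * (beta4 + beta5)) * (beta1 + beta2) / beta)
  /\
  (* (g) *)
  (Num.max mu1 mu2 < Q ->
   B1 < (alphahat * (beta1 + beta4) + alphabar * (beta2 + beta5)) / Q ->
   T = (alpha1 + alpha2)
       + (alpha + Q * (beta4 + beta5)) * (beta1 + beta2) / beta
       + g * B1 / beta).
Proof.
move=> alpha1 beta1 alpha2 beta2 alpha3 beta3 alpha4 beta4 alpha5 beta5.
move=> alpha alphabar alphahat beta B1 mu1 mu2 g T.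
have b1 : 0 < beta1 := beta_gt0 Lab.
have b2 : 0 < beta2 := beta_gt0 Lbd.
have b3 : 0 < beta3 := beta_gt0 Lbc.
have b4 : 0 < beta4 := beta_gt0 Lac.
have b5 : 0 < beta5 := beta_gt0 Lcd.
have b12 : 0 < beta1 + beta2 by lra.
have b13 : 0 < beta1 + beta3 by lra.
have b14 : 0 < beta1 + beta4 by lra.
have b25 : 0 < beta2 + beta5 by lra.
have b35 : 0 < beta3 + beta5 by lra.
have b45 : 0 < beta4 + beta5 by lra.
have b134 : 0 < beta1 + beta3 + beta4 by lra.
have b235 : 0 < beta2 + beta3 + beta5 by lra.
have beta_pos : 0 < beta by rewrite /beta; lra.
have mu1_den : 0 < beta3 * (beta4 + beta5) + beta5 * (beta1 + beta4).
  by rewrite addr_gt0 // mulr_gt0.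
have mu2_den : 0 < beta1 * (beta2 + beta5) + beta3 * (beta1 + beta2).
  by rewrite addr_gt0 // mulr_gt0.
have g_den : 0 < beta3 * beta + (beta1 + beta4) * (beta2 + beta5).
  by rewrite addr_gt0 // mulr_gt0.
have TE x1 x2 x3 w1 w2 w3 U :=
  @T_Eq_slack R alpha_ beta_ Q x1 x2 x3 w1 w2 w3 U beta_gt0 Q_gt0.
rewrite -/T -/alpha1 -/beta1 -/alpha2 -/beta2 -/alpha3 -/beta3 -/alpha4 -/beta4
  -/alpha5 -/beta5 in TE.
(* The link parameters become atoms for the arithmetic tactics; the derived quantities such as
   [alpha] and [B1] can still be unfolded. *)
clearbody alpha1 beta1 alpha2 beta2 alpha3 beta3 alpha4 beta4 alpha5 beta5 T.
have b1n : beta1 + beta3 + beta4 != 0 by lra.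
have b2n : beta2 + beta3 + beta5 != 0 by lra.
have bn : beta1 + beta2 + beta4 + beta5 != 0 by apply: lt0r_neq0.
have gn := lt0r_neq0 g_den.
do 6?split.
- rewrite le_min !ler_pdivlMr // => /and3P[_ h1 h2].
  (* All traffic takes P3; the two bounds on [Q] say that P1 and P2 are no faster. *)
  apply: (TE 0 0 Q (alphahat - Q * (beta3 + beta5)) (alphabar - Q * (beta1 + beta3)) 0).
  + by split; lra.
  + by split; lra.
  + by split; rewrite ?mul0r ?mulr0.
  + by rewrite /alphahat; ring.
  + by rewrite /alphabar; ring.
  + by ring.
- rewrite le_min !ler_pdivlMr // => /and3P[_ h1 h2].
  (* All traffic takes P2. *)
  apply: (TE 0 Q 0 (- alpha - Q * (beta4 + beta5)) 0 (- alphabar - Q * beta4)).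
  + by split; lra.
  + by split; lra.
  + by split; rewrite ?mul0r ?mulr0.
  + by rewrite /alpha; ring.
  + by ring.
  + by rewrite /alphabar; ring.
- rewrite le_min !ler_pdivlMr // => /and3P[_ h1 h2].
  (* All traffic takes P1. *)
  apply: (TE Q 0 0 0 (alpha - Q * (beta1 + beta2)) (- alphahat - Q * beta2)).
  + by split; lra.
  + by split; lra.
  + by split; rewrite ?mul0r ?mulr0.
  + by ring.
  + by rewrite /alpha; ring.
  + by rewrite /alphahat; ring.
- rewrite gt_max ler_pdivlMr // !ltr_pdivrMr // => /andP[/andP[h1 h2] h3].
  (* P2 and P3 are used, and equating their times determines the flows. The lower bounds on [Q] make
     these positive; [Q <= mu1] makes the slack of P1 non-negative. *)
  apply: (TE 0 ((Q * (beta1 + beta3) - alphabar) / (beta1 + beta3 + beta4))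
    ((alphabar + Q * beta4) / (beta1 + beta3 + beta4))
    ((alphahat * (beta1 + beta4) - alpha * beta3
      - Q * (beta3 * (beta4 + beta5) + beta5 * (beta1 + beta4)))
     / (beta1 + beta3 + beta4)) 0 0).
  + split=> //; [by apply: divr_ge0; lra|by apply: divr_ge0; lra|by field].
  + by split=> //; apply: divr_ge0; lra.
  + by split; rewrite ?mul0r ?mulr0.
  + by rewrite /alphahat /alphabar /alpha; field.
  + by rewrite /alphabar; field.
  + by rewrite /alphabar; field.
- rewrite gt_max ler_pdivlMr // !ltr_pdivrMr // => /andP[/andP[h1 h2] h3].
  (* P1 and P3 are used. This mirrors the previous case under reversal of all links, which swaps the
     indices 1 with 5 and 2 with 4, hence [alphahat] with [alphabar], [mu1] with [mu2], and [alpha]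
     with its negative. *)
  apply: (TE ((Q * (beta3 + beta5) - alphahat) / (beta2 + beta3 + beta5)) 0
    ((alphahat + Q * beta2) / (beta2 + beta3 + beta5)) 0
    ((alphabar * (beta2 + beta5) + alpha * beta3
      - Q * (beta1 * (beta2 + beta5) + beta3 * (beta1 + beta2)))
     / (beta2 + beta3 + beta5)) 0).
  + split=> //; [by apply: divr_ge0; lra|by apply: divr_ge0; lra|by field].
  + by split=> //; apply: divr_ge0; lra.
  + by split; rewrite ?mul0r ?mulr0.
  + by rewrite /alphahat; field.
  + by rewrite /alphahat /alphabar /alpha; field.
  + by rewrite /alphahat; field.
- rewrite gt_max !ltr_pdivrMr // ler_pdivrMr // => /andP[h1 h2] h3.
  (* P1 and P2 are used with equal times; the condition on [B1] is the non-negativity of the slack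
     of P3, simplified by [alphabar = alpha + alphahat]. *)
  apply: (TE ((alpha + Q * (beta4 + beta5)) / beta)
    ((Q * (beta1 + beta2) - alpha) / beta) 0 0 0
    ((B1 * Q - (alphahat * (beta1 + beta4) + alphabar * (beta2 + beta5))) / beta)).
  + split=> //; [by apply: divr_ge0; lra|by apply: divr_ge0; lra|].
    by rewrite /beta; field.
  + by split=> //; apply: divr_ge0; lra.
  + by split; rewrite ?mul0r ?mulr0.
  + by rewrite /beta; field.
  + by rewrite /beta /alpha; field.
  + by rewrite /beta /B1 /alphahat /alphabar /alpha; field.
- rewrite /mu1 /mu2 gt_max !ltr_pdivrMr // ltr_pdivlMr // => /andP[h1 h2] h3.
  set D := beta3 * beta + (beta1 + beta4) * (beta2 + beta5) in g_den gn g *.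
  (* All slacks vanish, and the flows solve the linear system of equal times, with [g] the flow on
     P3. The bounds [mu1 < Q] and [mu2 < Q] give the signs of the flows on P1 and P2. *)
  apply: (TE ((Q * (beta3 * (beta4 + beta5) + beta5 * (beta1 + beta4))
        - (alphahat * (beta1 + beta4) - alpha * beta3)) / D)
    ((Q * (beta1 * (beta2 + beta5) + beta3 * (beta1 + beta2))
        - (alphabar * (beta2 + beta5) + alpha * beta3)) / D) g 0 0 0).
  + split; [by rewrite divr_ge0 ?subr_ge0 ?ltW|by rewrite divr_ge0 ?subr_ge0 ?ltW| |].
      (* Since [alphabar = alpha + alphahat], the numerator of [g] is the difference of the two
         sides of [h3]. *)
      rewrite /g divr_ge0 ?ltW //; move: h3.
      by rewrite /B1 /alphahat /alphabar /alpha /beta; lra.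
    by rewrite /g /D /alphahat /alphabar /alpha /B1 /beta; field.
  + by split.
  + by split; rewrite mulr0.
  + by rewrite /g /D /alphahat /alphabar /alpha /B1 /beta; field; apply/andP.
  + by rewrite /g /D /alphahat /alphabar /alpha /B1 /beta; field; apply/andP.
  + by rewrite /g /D /alphahat /alphabar /alpha /B1 /beta; field; apply/andP.
Qed.
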